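(* Let $X$ be a finite set with $|X|=v$, let $0<k<v$, and let $C$ be a completely transitive design in $J(v,k)$ admitting a completely transitive group that is intransitive on $X$; that is, $C$ is a nonempty set of $k$-subsets of $X$ and there is a subgroup $G\le \mathrm{Sym}(X)$, intransitive on $X$, whose orbits on the $k$-subsets of $X$ are exactly the cells of the distance partition of $J(v,k)$ with respect to $C$. Then there is a non-empty proper subset $Y$ of $X$ such that $C$ is the set of all $k$-subsets $\alpha$ of $X$ for which $|\alpha\cap Y|$ is maximal (so $C$ consists of all $k$-subsets containing $Y$ if $k\ge |Y|$, and of all $k$-subsets of $Y$ otherwise), and $\mathrm{Aut}(C)\cong \mathrm{Sym}(Y)\times\mathrm{Sym}(\overline{Y})$, where $\overline{Y}=X\setminus Y$. Moreover, any completely transitive group $H\le\mathrm{Sym}(X)$ having $C$ as one of its orbits on $k$-subsets is transitive on $\binom{Y}{j}\times\binom{\overline{Y}}{k-j}$ for each $j$ such that $0\le j\le\min\{k,|Y|\}$.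
   Context: The Johnson graph $J(v,k)$ has as vertices the $k$-subsets of a fixed $v$-set $X$, two being adjacent if they have exactly $k-1$ points in common. For a nonempty set $C$ of vertices, the distance partition with respect to $C$ is the partition $C_0=C,C_1,\ldots,C_r$ where $C_i$ consists of the vertices whose minimum distance to a vertex of $C$ is $i$, and $r$ is the maximum such distance. $\mathrm{Aut}(C)$ is the group of permutations of $X$ that map $C$ to itself in the induced action on $k$-subsets. $C$ is a completely transitive design if the cells of its distance partition are the orbits on $k$-subsets of $\mathrm{Aut}(C)$ (equivalently, of some subgroup of $\mathrm{Sym}(X)$). A subgroup of $\mathrm{Sym}(X)$ is called completely transitive if its orbits on $k$-subsets form the distance partition for some subset of the vertex set of $J(v,k)$. $\binom{Z}{j}$ denotes the set of $j$-subsets of $Z$ (empty if $j>|Z|$); a pair in $\binom{Y}{j}\times\binom{\overline{Y}}{k-j}$ is identified with the $k$-subset which is the union of its two entries. *)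

(* Defs.v *)
From mathcomp Require Import all_boot all_fingroup.

Set Implicit Arguments.
Unset Strict Implicit.
Unset Printing Implicit Defensive.

Import GroupScope.

Section GraphDistance.

Variables (T : finType) (e : rel T).

(* A shortest walk visits at most #|T| vertices, so it has length < #|T|:
   the value #|T| stands for an infinite distance. *)
Definition gdist (x y : T) : nat :=
  find (fun n => [exists p : n.-tuple T, path e x p && (last x p == y)])
       (iota 0 #|T|).

Definition dist_to_set (C : {set T}) (x : T) : nat :=
  \big[minn/#|T|]_(y in C) gdist x y.

(* V is the vertex set of the graph; the points of T outside V are isolated. *)
Definition covering_radius (V C : {set T}) : nat :=
  \max_(x in V) dist_to_set C x.

Definition distance_cell (V C : {set T}) (i : nat) : {set T} :=
  [set x in V | dist_to_set C x == i].

Definition distance_partition (V C : {set T}) : {set {set T}} :=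
  [set distance_cell V C (nat_of_ord i) | i : 'I_(covering_radius V C).+1].

End GraphDistance.

Section Johnson.

Variable X : finType.

Definition subsets_of_size (Z : {set X}) (j : nat) : {set {set X}} :=
  [set A : {set X} | A \subset Z & #|A| == j].

Definition ksubsets (k : nat) : {set {set X}} := subsets_of_size [set: X] k.

(* Sets of size other than k are isolated points of this relation, so walks
   between k-subsets are exactly the walks of J(#|X|, k). *)
Definition johnson_adj (k : nat) : rel {set X} :=
  fun A B => [&& A \in ksubsets k, B \in ksubsets k & #|A :&: B| == k.-1].

Definition johnson_distance_partition (k : nat) (C : {set {set X}}) :=
  distance_partition (johnson_adj k) (ksubsets k) C.

Definition ksubset_orbits (k : nat) (G : {group {perm X}}) : {set {set {set X}}} :=
  [set orbit 'P^* G A | A in ksubsets k].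

Definition completely_transitive_group (k : nat) (G : {group {perm X}}) : Prop :=
  exists C : {set {set X}},
    [/\ C \subset ksubsets k, C != set0
      & ksubset_orbits k G = johnson_distance_partition k C].

Definition AutC (C : {set {set X}}) : {set {perm X}} := 'N(C | 'P^*).

Canonical AutC_group C := [group of AutC C].

(* Pairs of a j-subset of Y and a (k - j)-subset of ~: Y, each pair being
   identified with its union; k - j is truncated, so this is only meaningful
   for j <= k. *)
Definition split_subsets (k : nat) (Y : {set X}) (j : nat) : {set {set X}} :=
  [set A :|: B | A in subsets_of_size Y j, B in subsets_of_size (~: Y) (k - j)].

(* [transitive H, on S | 'P^*] is false when S is empty, whereas every group
   is vacuously transitive on the empty set. *)
Definition transitive_on_subsets (H : {group {perm X}}) (S : {set {set X}}) : Prop :=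
  S = set0 \/ [transitive H, on S | 'P^*].

End Johnson.

(* Main.v *)
(* The distance d to C is 1-Lipschitz on J(v,k), and two k-subsets lie in the
   same G-orbit iff d agrees on them. Let Y be a proper nonempty G-invariant
   set of points and let the level m be the set of k-subsets meeting Y in m
   points. Levels are unions of orbits and are connected in J(v,k), and every
   vertex of a level has neighbours in a fixed adjacent level. This forces each
   level to be a single orbit. In particular C is a level; all its neighbours
   lie in one orbit, hence in one level, so C is the top or the bottom level for
   Y, that is, the top level for Y or for its complement. Finally C determines
   Y, so Aut(C) is the stabiliser of Y, and any completely transitive H having C
   as an orbit fixes Y, so that the levels are also H-orbits. *)

Require Import Defs.
From mathcomp Require Import all_boot all_fingroup.

Set Implicit Arguments.
Unset Strict Implicit.
Unset Printing Implicit Defensive.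

Import GroupScope.

(** * Distances in a finite graph, with the number of vertices as infinity *)

Lemma gdist_le (T : finType) (e : rel T) (x y : T) : gdist e x y <= #|T|.
Proof. by rewrite -[X in _ <= X](size_iota 0) find_size. Qed.

Lemma gdist_le_path (T : finType) (e : rel T) (x : T) (p : seq T) :
  path e x p -> gdist e x (last x p) <= size p.
Proof.
(* A walk too long to be found by the search is covered by the default value [#|T|]. *)
move=> xp; case: (ltnP (size p) #|T|) => [ltp |]; last first.
  exact: leq_trans (gdist_le _ _ _).
rewrite leqNgt; apply/negP => /(before_find 0)/negbT/negP; apply.
rewrite nth_iota // add0n; apply/existsP; exists (in_tuple p).
by rewrite /= xp eqxx.
Qed.

Lemma gdist_path (T : finType) (e : rel T) (x y : T) :
  gdist e x y < #|T| ->
  exists2 p, path e x p & y = last x p /\ size p = gdist e x y.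
Proof.
move=> fin; have := fin; rewrite -[X in _ < X](size_iota 0) -has_find.
move/(nth_find 0); rewrite -/(gdist e x y) nth_iota // add0n => /existsP[p].
by case/andP=> xp /eqP lp; exists p => //; rewrite lp size_tuple.
Qed.

Lemma gdist_adj (T : finType) (e : rel T) (x z y : T) :
  e x z -> gdist e x y <= (gdist e z y).+1.
Proof.
move=> xz; have := gdist_le e z y; rewrite leq_eqVlt => /orP[/eqP-> | fin].
  exact: leq_trans (gdist_le e x y) _.
have [p zp [-> <-]] := gdist_path fin.
by apply: (@gdist_le_path _ e x (z :: p)); rewrite /= xz.
Qed.

Lemma gdist_eq0 (T : finType) (e : rel T) (x y : T) :
  (gdist e x y == 0) = (x == y).
Proof.
apply/eqP/eqP => [d0 | <-]; last first.
  by apply/eqP; rewrite -leqn0 (@gdist_le_path _ e x [::]).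
have fin : gdist e x y < #|T| by rewrite d0; apply/card_gt0P; exists x.
by have [p _ [yE]] := gdist_path fin; rewrite d0 yE => /size0nil->.
Qed.

Lemma dist_to_set_le (T : finType) (e : rel T) (C : {set T}) (x y : T) :
  y \in C -> dist_to_set e C x <= gdist e x y.
Proof.
move=> yC; rewrite /dist_to_set.
have: y \in index_enum T by rewrite mem_index_enum.
elim: (index_enum T) => // z r IHr; rewrite inE big_cons.
case/orP=> [/eqP<- | /IHr le_r]; first by rewrite yC geq_minl.
by case: ifP => // _; apply: leq_trans (geq_minr _ _) le_r.
Qed.

Lemma dist_to_set_attained (T : finType) (e : rel T) (C : {set T}) (x : T) :
  dist_to_set e C x = #|T| \/
  exists2 y, y \in C & dist_to_set e C x = gdist e x y.
Proof.
pose P n := n = #|T| \/ exists2 y, y \in C & n = gdist e x y.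
apply: (big_ind P); first by left.
  by move=> m n Pm Pn; rewrite /minn; case: ifP.
by move=> y yC; right; exists y.
Qed.

Lemma dist_to_set_adj (T : finType) (e : rel T) (C : {set T}) (x z : T) :
  e x z -> dist_to_set e C x <= (dist_to_set e C z).+1.
Proof.
move=> xz; have [->|[y yC ->]] := dist_to_set_attained e C z; last first.
  exact: leq_trans (dist_to_set_le e x yC) (gdist_adj y xz).
apply: leqW; have [->|[y yC ->]] := dist_to_set_attained e C x => //.
exact: gdist_le.
Qed.

Lemma dist_to_set_eq0 (T : finType) (e : rel T) (C : {set T}) (x : T) :
  (dist_to_set e C x == 0) = (x \in C).
Proof.
apply/idP/idP => [|xC]; last first.
  by rewrite -leqn0 -[0](eqP (_ : gdist e x x == 0)) ?dist_to_set_le ?gdist_eq0.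
have [->|[y yC ->]] := dist_to_set_attained e C x; last first.
  by rewrite gdist_eq0 => /eqP->.
(* The default value is not 0, since [x] inhabits [T]. *)
by rewrite (cardD1 x).
Qed.

(** * Exchanging points, and the levels of the Johnson graph *)

Section Levels.

Variable X : finType.
Implicit Types (A B D E Y : {set X}) (C : {set {set X}}) (k : nat).

Lemma in_ksubsets k A : (A \in ksubsets X k) = (#|A| == k).
Proof. by rewrite inE subsetT. Qed.

Definition swap A (x y : X) : {set X} := y |: (A :\ x).

(** The additive form avoids truncated subtraction. Taking [setT] or [A] for [Y] gives the size of
    the exchange and its adjacency to [A]. *)
Lemma card_swapI A Y x y : x \in A -> y \notin A ->
  (#|swap A x y :&: Y| + (x \in Y) = #|A :&: Y| + (y \in Y))%N.
Proof.
move=> xA yA; have -> : #|A :&: Y| = ((x \in Y) + #|(A :\ x) :&: Y|)%N.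
  by rewrite (cardsD1 x) inE xA setIDAC.
rewrite [X in (X + _)%N](_ : _ = ((y \in Y) + #|(A :\ x) :&: Y|)%N).
  by rewrite addnC -[RHS]addnA (addnC _ (y \in Y)).
rewrite setIUl; have [yY|yY] := boolP (y \in Y).
  by rewrite (setIidPl _) ?sub1set // cardsU1 !inE (negPf yA) andbF.
by rewrite (_ : _ :&: Y = set0) ?set0U //; apply/setP=> z;
   rewrite !inE; case: eqP => // ->; rewrite (negPf yY).
Qed.

Lemma card_swap A x y : x \in A -> y \notin A -> #|swap A x y| = #|A|.
Proof.
by move=> xA yA; have := card_swapI setT xA yA; rewrite !setIT !inE => /addIn.
Qed.

Lemma johnson_adj_swap k A x y :
  #|A| = k -> x \in A -> y \notin A -> johnson_adj k A (swap A x y).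
Proof.
move=> cA xA yA; rewrite /johnson_adj !in_ksubsets card_swap // cA eqxx /=.
have := card_swapI A xA yA; rewrite xA (negPf yA) setIid setIC cA addn0 => <-.
by rewrite addn1.
Qed.

Lemma johnson_adjC k A B : johnson_adj k A B = johnson_adj k B A.
Proof. by rewrite /johnson_adj setIC andbCA. Qed.

Lemma johnson_adj_card k A B : johnson_adj k A B -> #|A| = k /\ #|B| = k.
Proof. by rewrite /johnson_adj !in_ksubsets => /and3P[/eqP-> /eqP->]. Qed.

Lemma card_capC A Y : (#|A :&: Y| + #|A :&: ~: Y| = #|A|)%N.
Proof. by rewrite -setDE cardsID. Qed.

Lemma exists_swap_target A B Z x :
  #|A :&: Z| = #|B :&: Z| -> x \in A -> x \in Z -> x \notin B ->
  exists y, [/\ y \in B, y \in Z & y \notin A].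
Proof.
move=> eqAB xA xZ xB.
have /subsetPn[y] : ~~ (B :&: Z \subset A :&: Z).
  apply/negP=> sBA; have /eqP eBA : B :&: Z == A :&: Z.
    by rewrite eqEcard sBA eqAB /=.
  by have /setIP[] : x \in B :&: Z; rewrite ?eBA ?inE ?xA ?(negPf xB).
by rewrite !inE => /andP[yB yZ]; rewrite yZ andbT => yA; exists y.
Qed.

(** Connectedness of a level, as an induction principle: exchanging a point of [A :\: B] for one of
    [B :\: A] on the same side of [Y] stays in the level and brings [A] closer to [B]. *)
Lemma level_connected k Y (P : {set X} -> Prop) A B :
  (forall D E, johnson_adj k D E -> #|D :&: Y| = #|E :&: Y| -> P D -> P E) ->
  #|A| = k -> #|B| = k -> #|A :&: Y| = #|B :&: Y| -> P A -> P B.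
Proof.
move=> stepP; have [n] := ubnP #|A :\: B|.
elim: n A => // n IHn A /ltnSE leAB cA cB eqY PA.
have [/eqP | [x]] := set_0Vmem (A :\: B).
  rewrite setD_eq0 => sAB; suff <- : A = B by [].
  by apply/eqP; rewrite eqEcard sAB cA cB /=.
rewrite inE => /andP[xB xA].
have eqYc : #|A :&: ~: Y| = #|B :&: ~: Y|.
  by apply: (@addnI #|A :&: Y|); rewrite {2}eqY !card_capC cA.
have [y [yB yA xyY]] : exists y,
    [/\ y \in B, y \notin A & (x \in Y) = (y \in Y)].
  have [xY|xY] := boolP (x \in Y).
    by have [y [? ? ?]] := exists_swap_target eqY xA xY xB; exists y.
  have xYc : x \in ~: Y by rewrite inE.
  have [y []] := exists_swap_target eqYc xA xYc xB.
  by rewrite inE => yB /negPf yY yA; exists y.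
have eqS : #|A :&: Y| = #|swap A x y :&: Y|.
  by have := card_swapI Y xA yA; rewrite xyY => /addIn.
apply: (IHn (swap A x y)); rewrite ?card_swap -?eqS //; last first.
  exact: stepP (johnson_adj_swap cA xA yA) eqS PA.
apply: leq_trans leAB; apply: proper_card; apply/properP; split.
  apply/subsetP=> z; rewrite !inE; case: eqP => [->|_] /=; first by rewrite yB.
  by case/and3P=> -> _ ->.
exists x; rewrite !inE ?xA ?xB ?eqxx ?andbF ?orbF //=.
by apply: contraNneq yA => <-.
Qed.

Lemma level_up k Y A : #|A| = k -> #|A :&: Y| < minn k #|Y| ->
  exists2 B, johnson_adj k A B & #|B :&: Y| = #|A :&: Y|.+1.
Proof.
rewrite leq_min => cA /andP[ltk ltY].
have /set0Pn[x /setDP[xA xY]] : A :\: Y != set0.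
  by rewrite -card_gt0 cardsD cA subn_gt0.
have /set0Pn[y /setDP[yY yA]] : Y :\: A != set0.
  by rewrite -card_gt0 cardsD subn_gt0 setIC.
exists (swap A x y); first exact: johnson_adj_swap.
by have := card_swapI Y xA yA; rewrite yY (negPf xY) addn0 addn1.
Qed.

(* Either upwards or, applied to ~: Y, downwards; both fail only when
   k = 0 or k = #|X|. *)
Lemma level_neighbour k Y m : 0 < k < #|X| -> Y != set0 -> Y != setT ->
  exists2 m', m' != m &
    forall A, #|A| = k -> #|A :&: Y| = m ->
    exists2 B, johnson_adj k A B & #|B :&: Y| = m'.
Proof.
move=> /andP[k0 kX] Y0 YT.
have [ltm|lem] := ltnP m (minn k #|Y|).
  exists m.+1; first by rewrite neq_ltn ltnSn orbT.
  by move=> A cA mA; rewrite -mA in ltm *; apply: level_up.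
have cY : #|Y| + #|~: Y| = #|X| by rewrite cardsC.
have Yc0 : 0 < #|~: Y| by rewrite card_gt0 -setCT (inj_eq (@setC_inj X)).
have Yn0 : 0 < #|Y| by rewrite card_gt0.
have m0 : 0 < m by apply: leq_trans lem; rewrite leq_min k0 Yn0.
exists m.-1; first by rewrite neq_ltn prednK // leqnn.
move=> A cA mA; have cAc := card_capC A Y.
have [|B AB cB] := @level_up k (~: Y) A cA.
  rewrite leq_min; apply/andP; split.
    by rewrite -cA -cAc mA -[X in X < _]add0n ltn_add2r.
  (* There is room outside [A] in [~: Y]: either [A] lies inside [Y], or it contains [Y] and
     [k < #|X|] leaves a point over. *)
  move: lem; rewrite geq_min => /orP[km|Ym].
    suff -> : #|A :&: ~: Y| = 0 by [].
    apply/eqP; rewrite -leqn0 -(leq_add2l m) addn0.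
    by rewrite -[in X in X <= _]mA cAc cA.
  rewrite -(ltn_add2l m) -[in X in X < _]mA cAc cA; apply: leq_trans kX _.
  by rewrite -cY leq_add2r.
exists B => //; have [_ cBk] := johnson_adj_card AB.
apply: (@addIn #|A :&: ~: Y|.+1); rewrite -{1}cB card_capC cBk -cA -cAc mA.
by rewrite addnS -addSn prednK.
Qed.

Lemma card_setactI (g : {perm X}) Y A : g \in 'N(Y | 'P) ->
  #|'P^*%act A g :&: Y| = #|A :&: Y|.
Proof.
move=> gY; rewrite -[Y in LHS](astabs_setact gY) !setactE.
rewrite -imsetI ?card_imset //.
  exact: act_inj.
by move=> ? ? _ _; apply: act_inj.
Qed.

(** Each orbit is a distance cell. With the Lipschitz property this is all that [level_orbit] asks
    of the distance, so it serves [G] with [C] as well as [H] with a code of its own. *)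
Lemma ksubset_orbit_dist k C (G : {group {perm X}}) A B :
  ksubset_orbits k G = johnson_distance_partition k C ->
  #|A| = k -> #|B| = k ->
  (B \in orbit 'P^* G A) =
    (dist_to_set (johnson_adj k) C A == dist_to_set (johnson_adj k) C B).
Proof.
move=> Gcells cA cB.
have: orbit 'P^* G A \in ksubset_orbits k G.
  by apply: imset_f; rewrite in_ksubsets cA.
rewrite Gcells => /imsetP[i _ oA].
have := orbit_refl 'P^* G A; rewrite oA inE => /andP[_ /eqP->].
by rewrite inE in_ksubsets cB eqxx [RHS]eq_sym.
Qed.

(** * Orbits against levels, for an abstract distance function [d] *)

Section CompletelyTransitive.

Variables (k : nat) (G : {group {perm X}}) (d : {set X} -> nat).
Hypothesis d_adj : forall A B, johnson_adj k A B -> d A <= (d B).+1.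
Hypothesis d_orbit : forall A B, #|A| = k -> #|B| = k ->
  (B \in orbit 'P^* G A) = (d A == d B).

Variable Y : {set X}.

(** A discrete intermediate value argument: along an edge [d] changes by at most one, and levels are
    connected. *)
Lemma level_intermediate A B n :
  #|A| = k -> #|B| = k -> #|A :&: Y| = #|B :&: Y| -> d A <= n <= d B ->
  exists D, [/\ #|D| = k, #|D :&: Y| = #|A :&: Y| & d D = n].
Proof.
move=> cA cB eqY /andP[An nB].
(* Invariant along the level: [d] has not passed [n], or [n] has been attained. *)
pose P (D : {set X}) := d D <= n \/
  exists D, [/\ #|D| = k, #|D :&: Y| = #|A :&: Y| & d D = n].
pose Q (D : {set X}) := #|D :&: Y| = #|A :&: Y| /\ P D.
have : Q B.
  apply: (level_connected (P := Q) (A := A) (k := k) (Y := Y)) => //;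
    last first.
    by split=> //; left.
  move=> D E DE eqDE [eqD PD]; split; first by rewrite -eqDE.
  case: PD => [dD|]; last by right.
  have [dE|ltE] := leqP (d E) n; first by left.
  right; exists D; have [cD cE] := johnson_adj_card DE; split=> //.
  apply/eqP; rewrite eqn_leq dD -ltnS; apply: leq_trans ltE _.
  by apply: d_adj; rewrite johnson_adjC.
case=> _ [dB|//]; exists B; split=> //.
by apply/eqP; rewrite eqn_leq dB.
Qed.

Hypotheses (k0 : 0 < k) (kX : k < #|X|).
Hypotheses (Y0 : Y != set0) (YT : Y != setT) (GY : G \subset 'N(Y | 'P)).

Lemma orbit_card A B : B \in orbit 'P^* G A ->
  #|B :&: Y| = #|A :&: Y|.
Proof.
by case/imsetP=> g gG ->; rewrite card_setactI // (subsetP GY).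
Qed.

Lemma cell_card A B : #|A| = k -> #|B| = k -> d A = d B ->
  #|A :&: Y| = #|B :&: Y|.
Proof.
by move=> cA cB dAB; apply: orbit_card; rewrite d_orbit // dAB.
Qed.

(* If a level meets two cells then it meets two consecutive ones, i and i+1.
   The neighbours of these in an adjacent level lie in the cells i-1 and i+2,
   so that adjacent level, being connected, meets cell i as well. *)
Lemma level_cell_leq A B : #|A| = k -> #|B| = k ->
  #|A :&: Y| = #|B :&: Y| -> d B <= d A.
Proof.
move=> cA cB eqY; rewrite leqNgt; apply/negP=> ltAB.
have [|D [cD mD dD]] := @level_intermediate A B (d A).+1 cA cB eqY.
  by rewrite leqnSn.
have kv : 0 < k < #|X| by rewrite k0.
have [m' neqm nbr] := level_neighbour #|A :&: Y| kv Y0 YT.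
have [A' AA' mA'] := nbr A cA erefl; have [_ cA'] := johnson_adj_card AA'.
have [D' DD' mD'] := nbr D cD mD; have [_ cD'] := johnson_adj_card DD'.
have [E [cE mE dE]] : exists E,
    [/\ #|E| = k, #|E :&: Y| = #|A' :&: Y| & d E = d A].
  apply: (@level_intermediate A' D') => //; first by rewrite mA'.
  apply/andP; split.
    (* If [d A'] were [(d A).+1], which is [d D], then [A'] and [D] would share a cell and hence a
       level. *)
    have := d_adj AA'; rewrite johnson_adjC in AA'.
    have := d_adj AA'; rewrite leq_eqVlt => /orP[/eqP e _|//].
    by case/eqP: neqm; rewrite -mA' -mD; apply: cell_card; rewrite // e dD.
  by have := d_adj DD'; rewrite dD.
by case/eqP: neqm; rewrite -mA' -mE; apply: cell_card.
Qed.

Lemma level_orbit A B : #|A| = k -> #|B| = k ->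
  #|A :&: Y| = #|B :&: Y| -> B \in orbit 'P^* G A.
Proof.
by move=> cA cB eqY; rewrite d_orbit // eqn_leq !level_cell_leq.
Qed.

Variable C : {set {set X}}.
Hypothesis Ck : C \subset ksubsets X k.
Hypothesis dC : forall A, (d A == 0) = (A \in C).

(** [C] is the cell [d = 0]: a cell lies inside one level, and a level inside one orbit. *)
Lemma code_level A : A \in C ->
  C = [set B in ksubsets X k | #|B :&: Y| == #|A :&: Y|].
Proof.
move=> AC; have cA : #|A| = k by apply/eqP; rewrite -in_ksubsets (subsetP Ck).
have dA : d A = 0 by apply/eqP; rewrite dC.
apply/setP=> B; rewrite inE in_ksubsets.
apply/idP/andP=> [BC | [/eqP cB /eqP eqY]].
  have cB : #|B| = k by apply/eqP; rewrite -in_ksubsets (subsetP Ck).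
  rewrite cB eqxx; split=> //; apply/eqP/cell_card => //.
  by rewrite dA; apply/eqP; rewrite dC.
by have := level_orbit cB cA eqY; rewrite d_orbit // dA dC.
Qed.

(* Otherwise C would have neighbours in the levels above and below it, and all
   of these would lie in the single cell at distance 1. *)
Lemma code_extremal A : A \in C ->
  #|A :&: Y| = minn k #|Y| \/ #|A :&: ~: Y| = minn k #|~: Y|.
Proof.
move=> AC; have cA : #|A| = k by apply/eqP; rewrite -in_ksubsets (subsetP Ck).
have le_min Z : #|A :&: Z| <= minn k #|Z|.
  by rewrite leq_min -{1}cA !subset_leq_card ?subsetIl ?subsetIr.
have := le_min Y; rewrite leq_eqVlt => /orP[/eqP->|ltY]; first by left.
have := le_min (~: Y); rewrite leq_eqVlt => /orP[/eqP->|ltYc]; first by right.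
have [B AB mB] := level_up cA ltY; have [D AD mD] := level_up cA ltYc.
have [_ cB] := johnson_adj_card AB; have [_ cD] := johnson_adj_card AD.
(* At fixed size [k], a point gained outside [Y] is a point lost in [Y]. *)
have mDY : #|D :&: Y|.+1 = #|A :&: Y|.
  apply: (@addIn #|A :&: ~: Y|); rewrite card_capC cA -cD.
  by rewrite addSn -addnS -mD card_capC.
have d1 E : johnson_adj k A E -> #|E :&: Y| != #|A :&: Y| -> d E = 1%N.
  move=> AE; rewrite johnson_adjC in AE; have := d_adj AE.
  have dA : d A = 0 by apply/eqP; rewrite dC.
  rewrite dA leq_eqVlt => /orP[/eqP//|]; rewrite ltnS leqn0 dC.
  by rewrite (code_level AC) inE => /andP[_ ->].
have := cell_card cB cD; rewrite mB -mDY !d1 ?mB -?mDY ?neq_ltn ?leqnn ?orbT //.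
by move=> /(_ erefl)/eqP; rewrite -[X in _ == X]addn0 -addn2 eqn_add2l.
Qed.

End CompletelyTransitive.

(** * The top level of a point set and its stabiliser *)

Definition full_level k Y : {set {set X}} :=
  [set A in ksubsets X k | #|A :&: Y| == minn k #|Y|].

Lemma full_level_supset k Y A : #|Y| <= k ->
  (A \in full_level k Y) = (#|A| == k) && (Y \subset A).
Proof.
move=> Yk; rewrite inE in_ksubsets (minn_idPr Yk) (sameP setIidPr eqP).
rewrite eqEcard subsetIr /=.
by congr andb; rewrite eqn_leq subset_leq_card ?subsetIr.
Qed.

Lemma full_level_subset k Y A : k <= #|Y| ->
  (A \in full_level k Y) = (#|A| == k) && (A \subset Y).
Proof.
move=> kY; rewrite inE in_ksubsets (minn_idPl kY); case: eqP => //= <-.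
rewrite (sameP setIidPl eqP) eqEcard subsetIl.
by rewrite eqn_leq subset_leq_card ?subsetIl.
Qed.

(** The level determines [Y], as the intersection of its members if [#|Y| <= k] and as their union
    otherwise. *)
Lemma full_level_stab k Y : 0 < k < #|X| -> full_level k Y != set0 ->
  AutC (full_level k Y) = 'N(Y | 'P).
Proof.
move=> /andP[k0 kX] /set0Pn[A AC].
apply/eqP; rewrite eqEsubset; apply/andP; split; last first.
  apply/subsetP=> g gY; apply/astabsP=> B.
  by rewrite !inE !subsetT card_setactI // card_setact.
apply/subsetP=> g gC; rewrite !inE; apply/subsetP=> x xY; rewrite inE /= apermE.
have CC B : B \in full_level k Y -> 'P^*%act B g \in full_level k Y.
  by rewrite (astabs_act B gC).
have gP B : (g x \in 'P^*%act B g) = (x \in B).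
  by rewrite /= setactE (mem_imset _ _ (act_inj 'P g)).
have [Yk|/ltnW kY] := leqP #|Y| k.
  apply: contraLR xY => gxY.
  have [B BC gxB] : exists2 B, B \in full_level k Y & g x \notin B.
    have := AC; rewrite full_level_supset // => /andP[/eqP cA YA].
    have [gxA|] := boolP (g x \in A); last by exists A.
    have /subsetPn[y _ yA] : ~~ ([set: X] \subset A).
      rewrite subTset; apply: contraL kX => /eqP AT.
      by rewrite -cA AT cardsT ltnn.
    (* Exchanging [g x], which is outside [Y], for a point outside [A] keeps [Y] covered. *)
    exists (swap A (g x) y); last first.
      by rewrite !inE eqxx orbF; apply: contraNneq yA => <-.
    rewrite full_level_supset // card_swap // cA eqxx; apply/subsetP=> z zY.
    rewrite !inE (subsetP YA) // andbT orbC; case: eqP => // zgx.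
    by rewrite -zgx zY in gxY.
  have : 'P^*%act B g^-1 \in full_level k Y.
    by rewrite (astabs_act B (groupVr gC)).
  rewrite full_level_supset // => /andP[_ /subsetP YB].
  by apply: contra gxB => /YB; rewrite -gP actKV.
have [B BC xB] : exists2 B, B \in full_level k Y & x \in B.
  have := AC; rewrite full_level_subset // => /andP[/eqP cA AY].
  have [xA|xA] := boolP (x \in A); first by exists A.
  have /card_gt0P[y yA] : 0 < #|A| by rewrite cA.
  exists (swap A y x); last by rewrite !inE eqxx.
  rewrite full_level_subset // card_swap // cA eqxx /=; apply/subsetP=> z.
  by rewrite !inE => /orP[/eqP->|/andP[_ /(subsetP AY)]].
have := CC B BC; rewrite full_level_subset // => /andP[_ /subsetP]; apply.
by rewrite gP.
Qed.

(** Turns the product into a level, to which [level_orbit] applies; [j <= k] keeps [k - j] from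
    being truncated. *)
Lemma in_split_subsets k Y j A : j <= k ->
  (A \in split_subsets k Y j) = (#|A| == k) && (#|A :&: Y| == j).
Proof.
move=> jk; apply/imset2P/andP => [[A1 A2] | [/eqP cA /eqP cAY]].
  rewrite !inE => /andP[A1Y /eqP c1] /andP[A2Y /eqP c2] ->.
  have YA2 : A2 :&: Y = set0.
    by apply/eqP; rewrite setI_eq0 disjoints_subset.
  have AY : (A1 :|: A2) :&: Y = A1 by rewrite setIUl YA2 setU0; apply/setIidPl.
  rewrite AY c1; split=> //; rewrite -(card_capC _ Y) AY c1 setIUl.
  rewrite (setIidPl A2Y) (_ : A1 :&: ~: Y = set0) ?set0U ?c2 ?subnKC //.
  by apply/eqP; rewrite setI_eq0 disjoints_subset setCK.
exists (A :&: Y) (A :&: ~: Y); last by rewrite -setIUr setUCr setIT.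
  by rewrite inE subsetIr cAY eqxx.
by rewrite inE subsetIr -cA -(card_capC A Y) cAY addKn eqxx.
Qed.

End Levels.

(** A permutation preserving [Y] is its restriction to [Y] times one fixing [Y] pointwise. *)
Lemma Sym_dprod (X : finType) (Y : {set X}) :
  Sym Y \x Sym (~: Y) = 'N(Y | 'P).
Proof.
rewrite dprodE.
- apply/setP=> g; apply/mulsgP/idP => [[s t] | gY].
    rewrite /= !SymE setCK.
    move=> /(subsetP (astab_sub _ _)) sY /(subsetP (astab_sub _ _)) tY ->.
    by rewrite astabsC in sY; apply: groupM.
  exists (restr_perm Y g) ((restr_perm Y g)^-1 * g); rewrite ?mulKVg //.
    by rewrite inE restr_perm_on.
  rewrite /= SymE setCK; apply/astabP=> x xY /=; rewrite apermE permM.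
  have rY : (restr_perm Y g)^-1 x \in Y.
    by rewrite -(perm_closed _ (restr_perm_on Y g)) permKV.
  by rewrite -(restr_permE gY rY) permKV.
- apply/centsP=> s; rewrite inE => sY t; rewrite inE => tY.
  by apply: perm_onC sY tY _; rewrite disjoints_subset.
apply/trivgP/subsetP=> s; rewrite !inE => /andP[sY sYc]; apply/eqP/permP=> x.
rewrite perm1; have [xY|xY] := boolP (x \in Y).
  by rewrite (out_perm sYc) // inE xY.
by rewrite (out_perm sY).
Qed.

Theorem lemma3p1 (X : finType) (v k : nat) (hv : #|X| = v)
    (hk0 : 0 < k) (hkv : k < v)
    (C : {set {set X}}) (hCsub : C \subset ksubsets X k) (hCne : C != set0)
    (G : {group {perm X}})
    (hGintrans : ~~ [transitive G, on [set: X] | 'P])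
    (hG : ksubset_orbits k G = johnson_distance_partition k C) :
  exists Y : {set X},
    [/\ Y != set0, Y \proper [set: X],
        [/\ C = [set A in ksubsets X k |
                  [forall (B | B \in ksubsets X k), #|B :&: Y| <= #|A :&: Y|]],
            #|Y| <= k -> C = [set A in ksubsets X k | Y \subset A]
          & k < #|Y| -> C = subsets_of_size Y k],
        AutC C \isog setX (Sym Y) (Sym (~: Y))
      & forall H : {group {perm X}},
          completely_transitive_group k H -> C \in ksubset_orbits k H ->
          forall j : nat, j <= minn k #|Y| ->
            transitive_on_subsets H (split_subsets k Y j)].
Proof.
subst v; have hk : 0 < k < #|X| by rewrite hk0.
have d_adj (C' : {set {set X}}) A B :=
  @dist_to_set_adj _ (johnson_adj k) C' A B.
have d_eq0 A := @dist_to_set_eq0 _ (johnson_adj k) C A.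
have d_orbit A B := @ksubset_orbit_dist _ k C G A B hG.
have [Y [Y0 YT CY]] : exists Y : {set X},
    [/\ Y != set0, Y != setT & C = full_level k Y].
  have /card_gt0P[x _] : 0 < #|X| by apply: leq_ltn_trans hkv.
  (* By intransitivity any point orbit is a proper invariant set. *)
  pose Y := orbit 'P G x.
  have Y0 : Y != set0 by apply/set0Pn; exists x; apply: orbit_refl.
  have YT : Y != setT.
    by apply: contraNneq hGintrans => YT; apply/imsetP; exists x; rewrite ?inE.
  have GY : G \subset 'N(Y | 'P) by rewrite acts_orbit ?subsetT.
  have /set0Pn[A AC] := hCne.
  have GYc : G \subset 'N(~: Y | 'P) by rewrite astabsC.
  have Yc0 : ~: Y != set0 by rewrite -setCT (inj_eq (@setC_inj X)).
  have YcT : ~: Y != setT by rewrite -setC0 (inj_eq (@setC_inj X)).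
  have levelC Z : Z != set0 -> Z != setT -> G \subset 'N(Z | 'P) ->
      #|A :&: Z| = minn k #|Z| -> C = full_level k Z.
    move=> Z0 ZT GZ mA; rewrite /full_level -mA.
    by apply: (code_level (d_adj C) d_orbit) => // B; apply: d_eq0.
  have [/levelC|/levelC] :=
      code_extremal (d_adj C) d_orbit hk0 hkv Y0 YT GY hCsub d_eq0 AC.
    by exists Y; split; auto.
  (* If [C] is the bottom level for the orbit, its complement is the set sought. *)
  by exists (~: Y); split; auto.
have [A AC] := set0Pn _ hCne.
have autC : AutC C = 'N(Y | 'P) by rewrite CY full_level_stab // -CY.
exists Y; split=> //.
- by rewrite properT.
- split.
  + apply/setP=> B; rewrite CY [RHS]inE [LHS]inE; case Bk: (B \in _) => //=.
    apply/eqP/forall_inP => [mB D | maxB].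
      rewrite in_ksubsets mB leq_min => /eqP <-.
      by rewrite !subset_leq_card ?subsetIl ?subsetIr.
    apply/eqP; rewrite eqn_leq; apply/andP; split.
      move: Bk; rewrite in_ksubsets leq_min => /eqP <-.
      by rewrite !subset_leq_card ?subsetIl ?subsetIr.
    (* The bound [minn k #|Y|] is attained, namely by the member [A] of [C]. *)
    by move: AC; rewrite CY inE => /andP[Ak /eqP <-]; apply: maxB.
  + move=> Yk; apply/setP=> B.
    by rewrite CY full_level_supset // inE in_ksubsets.
  move=> /ltnW kY; apply/setP=> B.
  by rewrite CY full_level_subset // inE andbC.
- by rewrite autC isog_sym; apply: misom_isog (introT mulgmP (Sym_dprod Y)).
move=> H [C' [C'k C'0 hH]] /imsetP[D _ CD] j jY.
(* [H] preserves its orbit [C], so it lies in [AutC C] and preserves [Y]. *)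
have HY : H \subset 'N(Y | 'P) by rewrite -autC CD acts_orbit ?subsetT.
have jk : j <= k by apply: leq_trans jY (geq_minl _ _).
have [->|/set0Pn[B BS]] := eqVneq (split_subsets k Y j) set0; [by left | right].
have := BS; rewrite in_split_subsets // => /andP[/eqP cB /eqP mB].
apply/imsetP; exists B => //; apply/setP=> E; rewrite in_split_subsets //.
apply/andP/idP => [[/eqP cE /eqP mE]|BE].
  (* The distance is now taken to [C'], which may differ from [C]. *)
  have H_orbit A' B' := @ksubset_orbit_dist _ k C' H A' B' hH.
  by apply: (level_orbit (d_adj C') H_orbit hk0 hkv Y0 YT HY) => //; rewrite mB.
split; last by rewrite (orbit_card HY BE) mB.
by case/imsetP: BE => h _ ->; rewrite card_setact cB.
Qed.
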